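(* Let $G$ be a topological group and let $\mathcal{S}$ be a $G$-stable local filter. Then the following hold. (1) The topological group $\hat{G}_{\mathcal{S}}$ is a t.d.l.c. completion of $G$ (via $\beta_{(G,\mathcal{S})}$). (2) There is a one-to-one correspondence between $\mathcal{U}(\hat{G}_{\mathcal{S}})$ and $\mathcal{S}$ given as follows: for a compact open subgroup $R$ of $\hat{G}_{\mathcal{S}}$, the subgroup $\beta_{(G,\mathcal{S})}^{-1}(R)$ is the corresponding element of $\mathcal{S}$, and for $V\in\mathcal{S}$, the subgroup $\overline{\beta_{(G,\mathcal{S})}(V)}$ is the corresponding compact open subgroup of $\hat{G}_{\mathcal{S}}$. (3) For $V\in\mathcal{S}$, the subgroup $\overline{\beta_{(G,\mathcal{S})}(V)}$ is naturally isomorphic as a topological group to the profinite completion of $V$ with respect to the quotients $V/N$ such that $N\in\mathcal{S}$ and $N\trianglelefteq V$.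
   Context: Topological groups are Hausdorff. A t.d.l.c. group is a totally disconnected, locally compact (Hausdorff) topological group. A t.d.l.c. completion of $G$ is a t.d.l.c. group $H$ together with a continuous homomorphism $G\rightarrow H$ with dense image. $\mathcal{U}(H)$ denotes the set of compact open subgroups of $H$. Two subgroups $U,V$ of a group are commensurate if $U\cap V$ has finite index in both. A $G$-stable local filter is a set $\mathcal{S}$ of open subgroups of $G$ such that: (a) $\mathcal{S}$ is non-empty; (b) any two elements of $\mathcal{S}$ are commensurate; (c) finite intersections of elements of $\mathcal{S}$ lie in $\mathcal{S}$, and given $V\le W\le G$ with $|W:V|$ finite, $V\in\mathcal{S}$ implies $W\in\mathcal{S}$; (d) if $V\in\mathcal{S}$ and $g\in G$ then $gVg^{-1}\in\mathcal{S}$. Completion with respect to $\mathcal{S}$. A (right) $\mathcal{S}$-Cauchy filter in $G$ is a filter $f$ of subsets of $G$ such that for every $V\in\mathcal{S}$ there is exactly one right coset $Vg$ of $V$ with $Vg\in f$, and every element of $f$ contains a right coset of some element of $\mathcal{S}$. The set $\hat{G}_{\mathcal{S}}$ consists of all $\mathcal{S}$-Cauchy filters in $G$, with the topology of the uniformity whose entourages are $E_U=\{(f,f')\mid \exists g\in G: Ug\in f\cap f'\}$ for $U\in\mathcal{S}$. For $f,f'\in\hat{G}_{\mathcal{S}}$, the product $ff'$ is the $\mathcal{S}$-Cauchy filter generated by the sets $AB$ with $A\in f$, $B\in f'$; with this multiplication $\hat{G}_{\mathcal{S}}$ is a topological group. The map $\beta_{(G,\mathcal{S})}:G\rightarrow\hat{G}_{\mathcal{S}}$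 sends $g$ to the filter generated by $\{Vg\mid V\in\mathcal{S}\}$; it is a continuous homomorphism with dense image. The profinite completion of $V$ with respect to the finite quotients $V/N$ is the inverse limit of these quotients; ''naturally isomorphic'' means by an isomorphism compatible with the canonical maps from $V$ to the two groups.
   Formalization: In the definition of an S-Cauchy filter f, every element of f is required to contain a right coset of some element of S that itself belongs to f; without this the completion need not be Hausdorff or a group (e.g. G = Z, S = {p^k Z}). *)

(* Defs.v *)
From HB Require Import structures.
From mathcomp Require Import all_boot all_order.
From mathcomp Require Import all_classical topology.

Set Implicit Arguments.
Unset Strict Implicit.
Unset Printing Implicit Defensive.

Local Open Scope classical_set_scope.
Local Open Scope group_scope.

HB.mixin Record isTopologicalGroup G of Group G & Topological G := {
  mulg_continuous : continuous (fun p : G * G => p.1 * p.2);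
  invg_continuous : continuous (fun x : G => x^-1);
  topgroup_hausdorff : hausdorff_space G
}.

#[short(type="topologicalGroupType")]
HB.structure Definition TopologicalGroup :=
  {G of Group G & Topological G & isTopologicalGroup G}.

Definition is_subgroup (G : groupType) (A : set G) : Prop := group_closed [in A].

Definition rcoset (G : groupType) (A : set G) (g : G) : set G :=
  [set a * g | a in A].

Definition mulset (G : groupType) (A B : set G) : set G :=
  [set a * b | a in A & b in B].

Definition invset (G : groupType) (A : set G) : set G := [set a^-1 | a in A].

Definition conjset (G : groupType) (g : G) (A : set G) : set G :=
  [set g * a * g^-1 | a in A].

(* |V : U| is finite; meant for subgroups U contained in V. *)
Definition finite_index (G : groupType) (U V : set G) : Prop :=
  finite_set [set rcoset U g | g in V].

Definition commensurate (G : groupType) (U V : set G) : Prop :=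
  finite_index (U `&` V) U /\ finite_index (U `&` V) V.

Section SetLemmas.
Variable G : groupType.
Implicit Types (A B U V : set G) (g h x y : G).

Lemma is_subgroupP A :
  is_subgroup A <-> [/\ A 1, forall x y, A x -> A y -> A (x * y)
                        & forall x, A x -> A x^-1].
Proof.
split.
  move=> AG; have [A1 _] := AG; split.
  - exact/set_mem.
  - move=> x y /mem_set Ax /mem_set Ay; apply/set_mem.
    exact: (group_closedM AG).
  - move=> x /mem_set Ax; apply/set_mem; exact: (group_closedV AG).
case=> A1 AM AV; split; first exact/mem_set.
by move=> x y /set_mem Ax /set_mem Ay; apply/mem_set/AM => //; exact: AV.
Qed.

Lemma rcosetP A g x : rcoset A g x <-> A (x * g^-1).
Proof.
split; first by case=> a Aa <-; rewrite mulgK.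
by move=> Ax; exists (x * g^-1) => //; rewrite mulgVK.
Qed.

Lemma conjsetP A g x : conjset g A x <-> A (g^-1 * x * g).
Proof.
split; first by case=> a Aa <-; rewrite !mulgA mulVg mul1g mulgVK.
by move=> Ax; exists (g^-1 * x * g) => //; rewrite !mulgA mulgV mul1g mulgK.
Qed.

Lemma invsetP A x : invset A x <-> A x^-1.
Proof. by split=> [[a Aa <-]|Ax]; [rewrite invgK|exists x^-1; rewrite ?invgK]. Qed.

Lemma rcoset_id U g : is_subgroup U -> rcoset U g g.
Proof. by move=> /is_subgroupP[U1 _ _]; apply/rcosetP; rewrite mulgV. Qed.

Lemma rcoset_eq U g h : is_subgroup U -> rcoset U g h -> rcoset U h = rcoset U g.
Proof.
move=> /is_subgroupP[U1 UM UV] /rcosetP Uhg.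
apply/seteqP; split=> x /rcosetP Ux; apply/rcosetP.
  by rewrite -[x](mulgVK h) -mulgA; exact: UM.
rewrite -[x](mulgVK g) -mulgA; apply: UM => //.
by have := UV _ Uhg; rewrite invgM invgK.
Qed.

Lemma rcosetM V W g h : is_subgroup W -> W `<=` conjset g^-1 V ->
  is_subgroup V -> mulset (rcoset V g) (rcoset W h) = rcoset V (g * h).
Proof.
move=> Ws WV /is_subgroupP[_ VM _]; apply/seteqP; split=> x.
  case=> a /rcosetP Va [b /rcosetP Wb <-]; apply/rcosetP.
  have /conjsetP := WV _ Wb; rewrite invgK => Vb.
  by have := VM _ _ Va Vb; rewrite invgM !mulgA mulgVK.
move=> /rcosetP Vx; exists (x * h^-1); last first.
  by exists h; [exact: rcoset_id|rewrite mulgVK].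
by apply/rcosetP; move: Vx; rewrite invgM mulgA.
Qed.

Lemma invset_id V : is_subgroup V -> invset V = V.
Proof.
move=> /is_subgroupP[_ _ VV]; apply/seteqP; split=> x.
  by move=> /invsetP/VV; rewrite invgK.
by move=> Vx; apply/invsetP; exact: VV.
Qed.

Lemma rcoset_inv V g : is_subgroup V ->
  invset (rcoset V g) = rcoset (conjset g^-1 V) g^-1.
Proof.
move=> Vs; rewrite -{2}(invset_id Vs); apply/seteqP; split=> x.
  move=> /invsetP/rcosetP Vx; apply/rcosetP/conjsetP/invsetP.
  by rewrite !invgK mulgA mulgK invgM.
by move=> /rcosetP/conjsetP/invsetP Vx; apply/invsetP/rcosetP; move: Vx;
  rewrite !invgK mulgA mulgK invgM.
Qed.

Lemma conjsetM A g h : conjset g (conjset h A) = conjset (g * h) A.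
Proof.
apply/seteqP; split=> x.
  by move=> /conjsetP/conjsetP Ax; apply/conjsetP; move: Ax; rewrite invgM !mulgA.
by move=> /conjsetP Ax; apply/conjsetP/conjsetP; move: Ax; rewrite invgM !mulgA.
Qed.

Lemma conjset1 A : conjset 1 A = A.
Proof.
apply/seteqP; split=> x; first by move=> /conjsetP; rewrite invg1 mul1g mulg1.
by move=> Ax; apply/conjsetP; rewrite invg1 mul1g mulg1.
Qed.

Lemma mulsetA A B C : mulset A (mulset B C) = mulset (mulset A B) C.
Proof.
apply/seteqP; split=> x.
  case=> a Aa [_ [b Bb [c Cc <-]] <-].
  by exists (a * b); [exists a => //; exists b|exists c; rewrite // mulgA].
case=> _ [a Aa [b Bb <-]] [c Cc <-].
by exists a => //; exists (b * c); [exists b => //; exists c|rewrite mulgA].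
Qed.

End SetLemmas.

Record local_filter (G : topologicalGroupType) := LocalFilter {
  local_filter_set :> set G -> Prop;
  local_filter_subgroup : forall V, local_filter_set V -> is_subgroup V;
  local_filter_open : forall V, local_filter_set V -> open V;
  local_filter_nonempty : exists V, local_filter_set V;
  local_filter_commensurate : forall U V,
    local_filter_set U -> local_filter_set V -> commensurate U V;
  local_filterI : forall U V,
    local_filter_set U -> local_filter_set V -> local_filter_set (U `&` V);
  local_filterS : forall V W, is_subgroup W -> V `<=` W -> finite_index V W ->
    local_filter_set V -> local_filter_set W;
  local_filterJ : forall V g,
    local_filter_set V -> local_filter_set (conjset g V)
}.

(* In the last condition the coset contained in A must itself be a member of f,
   so that f is a minimal Cauchy filter.  Otherwise the completion would not be
   Hausdorff: for G = Z and S = {p^k Z | k}, the filter generated by the sets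
   p^k Z \ {0} contains exactly one coset of each p^k Z and each of its members
   contains a coset of some p^k Z, but it is not separated from the filter
   generated by the sets p^k Z. *)
Definition cauchy_filter (G : topologicalGroupType) (S : local_filter G)
    (f : set_system G) : Prop :=
  [/\ ProperFilter f,
      forall V, S V -> exists! C, range (rcoset V) C /\ f C
    & forall A, f A ->
        exists V g, [/\ S V, f (rcoset V g) & rcoset V g `<=` A]].

Record completion (G : topologicalGroupType) (S : local_filter G) := Completion {
  completion_filter :> set G -> Prop;
  completion_cauchy : cauchy_filter S completion_filter
}.

HB.instance Definition _ (G : topologicalGroupType) (S : local_filter G) :=
  gen_eqMixin (completion S).
HB.instance Definition _ (G : topologicalGroupType) (S : local_filter G) :=
  gen_choiceMixin (completion S).

Section Completion.
Variables (G : topologicalGroupType) (S : local_filter G).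
Implicit Types (U V W A B : set G) (g h x y : G) (f : completion S).

Lemma S1 V : S V -> V 1.
Proof. by move=> /local_filter_subgroup/is_subgroupP[]. Qed.

Lemma SM V x y : S V -> V x -> V y -> V (x * y).
Proof. by move=> /local_filter_subgroup/is_subgroupP[_ + _]; exact. Qed.

Lemma SV V x : S V -> V x -> V x^-1.
Proof. by move=> /local_filter_subgroup/is_subgroupP[_ _]; exact. Qed.

Lemma cfF f : Filter f.
Proof. by have [[]] := completion_cauchy f. Qed.
#[local] Existing Instance cfF.

Lemma cf_ex f V : S V -> exists g, f (rcoset V g).
Proof.
move=> SV0; have [_ /(_ _ SV0)[C [[[g _ <-] fC] _]] _] := completion_cauchy f.
by exists g.
Qed.

Lemma cf_meet f A B : f A -> f B -> A `&` B !=set0.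
Proof.
move=> fA fB; apply/set0P/eqP => AB0.
have [[+ _] _ _] := completion_cauchy f; apply; rewrite -AB0; exact: filterI.
Qed.

Lemma cf_sub f A : f A -> exists V g, [/\ S V, f (rcoset V g) & rcoset V g `<=` A].
Proof. by have [_ _] := completion_cauchy f; exact. Qed.

Lemma cf_nest f V W g h : S V -> S W -> V `<=` W ->
  f (rcoset V g) -> f (rcoset W h) -> rcoset W g = rcoset W h.
Proof.
move=> SV0 SW VW fV fW; have [x [/rcosetP Vx Wx]] := cf_meet fV fW.
have SWs := local_filter_subgroup SW.
by rewrite -(rcoset_eq SWs Wx); apply/esym/rcoset_eq => //; apply/rcosetP/VW.
Qed.

Lemma cf_uniq f V g h : S V ->
  f (rcoset V g) -> f (rcoset V h) -> rcoset V g = rcoset V h.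
Proof. by move=> SV0; apply: cf_nest => //. Qed.

Lemma cauchy_filterI (F : set_system G) : Filter F ->
  (forall V, S V -> exists g, F (rcoset V g)) ->
  (forall A, F A -> exists V g, [/\ S V, F (rcoset V g) & rcoset V g `<=` A]) ->
  cauchy_filter S F.
Proof.
move=> FF Fex Fsub.
have Fne A : F A -> A !=set0.
  move=> /Fsub[V [g [SV0 _ sub]]]; exists g; apply: sub.
  exact: rcoset_id (local_filter_subgroup SV0).
split=> //; first by split => // /Fne[].
move=> V SV0; have [g Fg] := Fex _ SV0; exists (rcoset V g); split.
  by split => //; exists g.
move=> _ [[h _ <-] Fh]; have [x [xg xh]] := Fne _ (filterI Fg Fh).
have SVs := local_filter_subgroup SV0.
by rewrite -(rcoset_eq SVs xg) -(rcoset_eq SVs xh).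
Qed.

Lemma cf_sub_eq f f' : (forall V g, S V -> f (rcoset V g) -> f' (rcoset V g)) ->
  f = f'.
Proof.
move=> ff'.
have E : completion_filter f = completion_filter f'.
  apply/seteqP; split=> A.
    move=> /cf_sub[V [g [SV0 fV VA]]]; exact: filterS VA (ff' _ _ SV0 fV).
  move=> /cf_sub[V [g [SV0 fV VA]]]; apply: filterS VA _.
  have [h fh] := cf_ex f SV0.
  by rewrite (cf_uniq SV0 fV (ff' _ _ SV0 fh)).
case: f f' E {ff'} => [f fP] [f' fP'] /= E; subst f'.
by congr Completion; exact: Prop_irrelevance.
Qed.

Definition entourage_of (U : set G) : set (completion S * completion S) :=
  [set p : completion S * completion S | exists g, p.1 (rcoset U g) /\ p.2 (rcoset U g)].

Definition completion_entourage : set_system (completion S * completion S) :=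
  filter_from S entourage_of.

Lemma completion_entourage_filter : Filter completion_entourage.
Proof.
apply: filter_from_filter; first exact: local_filter_nonempty.
move=> U V SU SV0; exists (U `&` V); first exact: local_filterI.
move=> [f f'] [g /= [fg f'g]].
split; exists g => /=; split; (apply: filterS; last first);
  try exact: fg; try exact: f'g; by move=> x /rcosetP[? ?]; apply/rcosetP.
Qed.

Lemma completion_entourage_diagonal E :
  completion_entourage E -> diagonal `<=` E.
Proof.
case=> U SU UE [f f'] /= /diagonalP ->; apply: UE.
by have [g fg] := cf_ex f' SU; exists g.
Qed.

Lemma completion_entourage_inv E :
  completion_entourage E -> completion_entourage E^-1%relation.
Proof.
by case=> U SU UE; exists U => // -[f f'] [g /= [fg f'g]]; apply: UE; exists g.
Qed.

Lemma completion_entourage_split E : completion_entourage E ->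
  exists2 E', completion_entourage E' & (E' \; E' `<=` E)%relation.
Proof.
case=> U SU UE; exists (entourage_of U); first by exists U.
move=> [f1 f3] [f2 /= [g /= [fg f'g]] [h /= [f'h fh]]]; apply: UE; exists g.
by rewrite /= {2}(cf_uniq SU f'g f'h).
Qed.

HB.instance Definition _ := isUniform.Build (completion S)
  completion_entourage_filter completion_entourage_diagonal
  completion_entourage_inv completion_entourage_split.

Lemma nbhs_completionP f (A : set (completion S)) :
  nbhs f A <-> exists U g, [/\ S U, f (rcoset U g) &
    [set f' : completion S | f' (rcoset U g)] `<=` A].
Proof.
rewrite nbhsP; split.
  case=> E [U SU UE] EA; have [g fg] := cf_ex f SU; exists U, g; split=> // f' f'g.
  by apply/EA/mem_set/UE; exists g.
case=> U [g [SU fg UA]]; exists (entourage_of U); first by exists U.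
move=> f' /set_mem[h /= [fh f'h]]; apply: UA => /=.
by rewrite (cf_uniq SU fg fh).
Qed.

Definition beta_filter (g : G) : set_system G :=
  filter_from S (fun V => rcoset V g).

Lemma beta_cauchy g : cauchy_filter S (beta_filter g).
Proof.
apply: cauchy_filterI.
- apply: filter_from_filter; first exact: local_filter_nonempty.
  move=> U V SU SV0; exists (U `&` V); first exact: local_filterI.
  by move=> x /rcosetP[? ?]; split; apply/rcosetP.
- by move=> V SV0; exists g; exists V.
- by move=> A [V SV0 VA]; exists V, g; split=> //; exists V.
Qed.

Definition beta (g : G) : completion S := Completion (beta_cauchy g).

Definition mul_filter (f f' : set_system G) : set_system G :=
  filter_from [set AB | f AB.1 /\ f' AB.2] (fun AB => mulset AB.1 AB.2).

Lemma mul_filter_rcoset f f' V W g h : S W -> W `<=` conjset g^-1 V -> S V ->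
  f (rcoset V g) -> f' (rcoset W h) -> mul_filter f f' (rcoset V (g * h)).
Proof.
move=> SW WV SV0 fg f'h; exists (rcoset V g, rcoset W h); first by split.
by rewrite /= (rcosetM _ (local_filter_subgroup SW)) //; apply: local_filter_subgroup SV0.
Qed.

Lemma mul_cauchy f f' : cauchy_filter S (mul_filter f f').
Proof.
apply: cauchy_filterI.
- apply: filter_from_filter; first by exists (setT, setT); split; exact: filterT.
  move=> [A B] [C D] [/= fA fB] [/= fC fD]; exists (A `&` C, B `&` D).
    by split; exact: (@filterI _ _ (cfF _)).
  move=> _ [a [Aa Ca] [b [Bb Db] <-]].
  by split; exists a => //; exists b.
- move=> V SV0; have [g fg] := cf_ex f SV0.
  have SVg := local_filterJ g^-1 SV0; have [h fh] := cf_ex f' SVg.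
  by exists (g * h); exact: mul_filter_rcoset fg fh.
- move=> C [[A B] [/= fA f'B] ABC].
  have [V [g [SV0 fg VA]]] := cf_sub fA; have [W [h [SW fh WB]]] := cf_sub f'B.
  have SVg := local_filterJ g^-1 SV0.
  have SW' := local_filterI SW SVg; have [h' fh'] := cf_ex f' SW'.
  exists V, (g * h'); split=> //.
    by apply: mul_filter_rcoset fg fh' => //; exact: subIsetr.
  rewrite -(rcosetM h' (local_filter_subgroup SW') (@subIsetr _ _ _)
    (local_filter_subgroup SV0)).
  apply: subset_trans ABC => _ [a Va [b Wb <-]].
  exists a; first exact: VA.
  exists b => //; apply: WB.
  rewrite -(cf_nest SW' SW _ fh' fh); last exact: subIsetl.
  by case/rcosetP: Wb => ? _; apply/rcosetP.
Qed.

Definition mul_completion f f' : completion S := Completion (mul_cauchy f f').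

Lemma S_bigcap (F : set (set G)) : finite_set F -> F !=set0 -> F `<=` S ->
  S (\bigcap_(A in F) A).
Proof.
move=> /finite_seqP[s ->]; elim: s => [|A s IH]; first by case.
move=> _ sS.
have SA : S A by apply: sS; rewrite /= mem_head.
have [->|/eqP s0] := eqVneq s [::].
  by rewrite (_ : [set` [:: A]] = [set A]) ?bigcap_set1 //;
    apply/seteqP; split=> x /=; rewrite inE => /eqP.
rewrite (_ : [set` A :: s] = A |` [set` s]); last first.
  apply/seteqP; split=> x /=; rewrite inE.
    by case/predU1P; [left|right].
  by case=> [->|xs]; rewrite ?eqxx // xs orbT.
rewrite bigcap_setU1; apply: local_filterI => //; apply: IH.
  by case: s s0 {sS} => // x s _; exists x; rewrite /= mem_head.
by move=> x xs; apply: sS; rewrite /= inE (xs : x \in s) orbT.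
Qed.

Lemma S_core V W : S V -> S W -> exists N, [/\ S N, N `<=` V, N `<=` W &
  forall v x, V v -> N x -> N (v^-1 * x * v)].
Proof.
move=> SV0 SW; pose D := V `&` W; have SD : S D := local_filterI SV0 SW.
have [fin _] := local_filter_commensurate SV0 SW; rewrite -/D in fin.
pose F := [set conjset v^-1 D | v in V].
have FE : F = (fun C => mulset (invset C) C) @` [set rcoset D g | g in V].
  rewrite /F image_comp; apply: eq_imagel => v Vv /=.
  apply/seteqP; split=> x.
    case=> d Dd <-; rewrite invgK; exists v^-1.
      by apply/invsetP; rewrite invgK; apply: rcoset_id (local_filter_subgroup SD).
    exists (d * v); last by rewrite mulgA.
    by exists d.
  case=> a /invsetP/rcosetP Da [b /rcosetP Db <-].
  apply/conjsetP; rewrite invgK.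
  by have := SM SD (SV SD Da) Db; rewrite invgM !invgK !mulgA.
have FS : F `<=` S by move=> _ [v Vv <-]; exact: local_filterJ.
have Ff : finite_set F by rewrite FE; exact: finite_image.
have F0 : F !=set0 by exists (conjset 1^-1 D); exists 1 => //; exact: S1.
have Nsub x : (\bigcap_(A in F) A) x -> D x.
  move=> /(_ (conjset 1^-1 D)) Nx.
  have /Nx/conjsetP : F (conjset 1^-1 D) by exists 1 => //; exact: S1.
  by rewrite invgK mul1g invg1 mulg1.
exists (\bigcap_(A in F) A); split.
- exact: S_bigcap.
- by move=> x /Nsub[].
- by move=> x /Nsub[].
- move=> v x Vv Nx _ [w Vw <-]; apply/conjsetP; rewrite invgK.
  have /Nx/conjsetP : F (conjset (w * v^-1)^-1 D).
    by exists (w * v^-1) => //; apply: SM => //; exact: SV.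
  by rewrite !invgM !invgK !mulgA.
Qed.

Lemma cf_lcoset f V : S V -> exists g, f (rcoset (conjset g V) g).
Proof.
move=> SV0; have [x fx] := cf_ex f SV0.
have [N [SN NV NW NJ]] := S_core SV0 (local_filterJ x SV0).
have [y fy] := cf_ex f SN.
have [_ [[n Nn <-] /rcosetP Vnyx]] := cf_meet fy fx.
have Vyx : V (y * x^-1).
  have := SM SV0 (SV SV0 (NV _ Nn)) Vnyx.
  by rewrite -(mulgA n) mulKg.
exists y; apply: filterS fy => z /rcosetP Nz; apply/rcosetP/conjsetP.
have := NW _ (NJ _ _ Vyx Nz).
move=> /conjsetP; rewrite invgM invgK !mulgA.
rewrite mulVg mul1g mulgVK.
by rewrite -!mulgA.
Qed.

Definition inv_filter (f : set_system G) : set_system G :=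
  [set A | f (invset A)].

Lemma inv_rcoset f V g : S V ->
  inv_filter f (rcoset V g^-1) <-> f (rcoset (conjset g V) g).
Proof.
by move=> /local_filter_subgroup Vs; rewrite /inv_filter /= rcoset_inv // !invgK.
Qed.

Lemma inv_cauchy f : cauchy_filter S (inv_filter f).
Proof.
apply: cauchy_filterI.
- split; rewrite /inv_filter /=.
  + by apply: (@filterS _ f _ setT) (@filterT _ f _) => x _; apply/invsetP.
  + move=> A B fA fB; apply: (@filterS _ f _ (invset A `&` invset B)) (@filterI _ f _ _ _ fA fB) => x [/invsetP ? /invsetP ?].
    by apply/invsetP.
  + by move=> A B AB; apply: (@filterS _ f _) => x /invsetP ?; apply/invsetP/AB.
- move=> V SV0; have [g fg] := cf_lcoset f SV0.
  by exists g^-1; apply/inv_rcoset.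
- move=> A /cf_sub[V [g [SV0 fg VA]]].
  exists (conjset g^-1 V), g^-1; have SVg := local_filterJ g^-1 SV0; split=> //.
    apply/inv_rcoset => //; apply: filterS fg => x /rcosetP ?.
    by apply/rcosetP/conjsetP/conjsetP; rewrite invgK !mulgA mulgV mul1g mulgK.
  rewrite -rcoset_inv; last exact: local_filter_subgroup SV0.
  move=> x /invsetP/VA/invsetP.
  by rewrite invgK.
Qed.

Definition inv_completion f : completion S := Completion (inv_cauchy f).

Lemma beta_rcoset g V : S V -> beta g (rcoset V g).
Proof. by exists V. Qed.

Lemma mul_rcoset f f' V g h : S V ->
  f (rcoset V g) -> f' (rcoset (conjset g^-1 V) h) ->
  mul_completion f f' (rcoset V (g * h)).
Proof. by move=> SV0; apply: mul_filter_rcoset => //; exact: local_filterJ. Qed.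

Lemma cf_eq f f' :
  (forall V, S V -> exists2 g, f (rcoset V g) & f' (rcoset V g)) -> f = f'.
Proof.
move=> ff'; apply: cf_sub_eq => V g SV0 fg; have [h fh f'h] := ff' _ SV0.
by rewrite (cf_uniq SV0 fg fh).
Qed.

Lemma mul_completionA : associative mul_completion.
Proof.
move=> f1 f2 f3; apply: cf_eq => V SV0.
have [g fg] := cf_ex f1 SV0; have SVg := local_filterJ g^-1 SV0.
have [h fh] := cf_ex f2 SVg; have SVgh := local_filterJ h^-1 SVg.
have [k fk] := cf_ex f3 SVgh.
exists (g * (h * k)); first by do 2![apply: mul_rcoset => //].
rewrite mulgA; apply: mul_rcoset => //; first exact: mul_rcoset.
by rewrite invgM -conjsetM.
Qed.

Lemma mul1_completion : left_id (beta 1) mul_completion.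
Proof.
move=> f; apply: cf_eq => V SV0; have [g fg] := cf_ex f SV0; exists (1 * g).
  apply: mul_rcoset => //; first exact: beta_rcoset.
  by rewrite invg1 conjset1.
by rewrite mul1g.
Qed.

Lemma mul_completion1 : right_id (beta 1) mul_completion.
Proof.
move=> f; apply: cf_eq => V SV0; have [g fg] := cf_ex f SV0; exists (g * 1).
  by apply: mul_rcoset => //; apply/beta_rcoset/local_filterJ.
by rewrite mulg1.
Qed.

Lemma mulV_completion : left_inverse (beta 1) inv_completion mul_completion.
Proof.
move=> f; apply: cf_eq => V SV0; have [g fg] := cf_lcoset f SV0.
exists (g^-1 * g); last by rewrite mulVg; exact: beta_rcoset.
by apply: mul_rcoset => //; [apply/inv_rcoset|rewrite invgK].
Qed.

Lemma mul_completionV : right_inverse (beta 1) inv_completion mul_completion.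
Proof.
move=> f; apply: cf_eq => V SV0; have [g fg] := cf_ex f SV0.
exists (g * g^-1); last by rewrite mulgV; exact: beta_rcoset.
apply: mul_rcoset => //; apply/inv_rcoset; first exact: local_filterJ.
by rewrite conjsetM mulgV conjset1.
Qed.

HB.instance Definition _ := isGroup.Build (completion S)
  mul_completionA mul1_completion mul_completion1
  mulV_completion mul_completionV.

Lemma completion_mulg_continuous :
  continuous (fun p : completion S * completion S => p.1 * p.2).
Proof.
move=> [f f'] A /nbhs_completionP[U [k [SU fk UA]]].
have [g fg] := cf_ex f SU; have SUg := local_filterJ g^-1 SU.
have [h fh] := cf_ex f' SUg.
exists ([set f1 : completion S | f1 (rcoset U g)],
        [set f1 : completion S | f1 (rcoset (conjset g^-1 U) h)]) => /=.
  split; apply/nbhs_completionP; first by exists U, g; split.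
  by exists (conjset g^-1 U), h; split.
move=> [f1 f2] [/= f1g f2h]; apply: UA => /=.
rewrite (cf_uniq SU fk (mul_rcoset SU fg fh)); exact: mul_rcoset.
Qed.

Lemma completion_invg_continuous : continuous (fun f : completion S => f^-1).
Proof.
move=> f A /nbhs_completionP[U [k [SU fk UA]]].
have [g fg] := cf_lcoset f SU.
apply/nbhs_completionP; exists (conjset g U), g; split=> //.
  exact: local_filterJ.
move=> f' /= f'g; apply: UA => /=.
have fi : f^-1 (rcoset U g^-1) by apply/inv_rcoset.
by rewrite (cf_uniq SU fk fi); apply/inv_rcoset.
Qed.

Lemma completion_hausdorff : hausdorff_space (completion S).
Proof.
move=> f f' ff'; apply: cf_eq => V SV0.
have [g fg] := cf_ex f SV0; exists g => //; have [h fh] := cf_ex f' SV0.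
have [f1 [/= f1g f1h]] : [set f1 : completion S | f1 (rcoset V g)] `&`
    [set f1 : completion S | f1 (rcoset V h)] !=set0.
  apply: ff'; apply/nbhs_completionP; first by exists V, g; split.
  by exists V, h; split.
by rewrite (cf_uniq SV0 f1g f1h).
Qed.

HB.instance Definition _ := isTopologicalGroup.Build (completion S)
  completion_mulg_continuous completion_invg_continuous completion_hausdorff.

Lemma beta_morphism : monoid_morphism beta.
Proof.
split=> // g h; apply: cf_eq => V SV0; exists (g * h); first exact: beta_rcoset.
apply: mul_rcoset => //; first exact: beta_rcoset.
exact/beta_rcoset/local_filterJ.
Qed.

HB.instance Definition _ := isUMagmaMorphism.Build G (completion S) beta
  beta_morphism.

End Completion.

Arguments beta {G} S g.

Lemma continuous_mulg (T : topologicalType) (G : topologicalGroupType)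
  (f g : T -> G) :
  continuous f -> continuous g -> continuous (fun x => f x * g x).
Proof.
move=> cf cg x; apply: continuous2_cvg; [|exact: cf|exact: cg].
exact: (mulg_continuous (f x, g x)).
Qed.

Record subgroup (G : groupType) := Subgroup {
  subgroup_set :> G -> Prop;
  subgroupP : is_subgroup subgroup_set
}.

Definition subgroup_type (G : groupType) (H : subgroup G) : Type :=
  set_type (subgroup_set H).

HB.instance Definition _ (G : groupType) (H : subgroup G) :=
  SubChoice.copy (subgroup_type H) (set_type (subgroup_set H)).
HB.instance Definition _ (G : groupType) (H : subgroup G) :=
  SubChoice_isSubGroup.Build G _ (subgroup_type H) (subgroupP H).

Section TopologicalSubgroup.
Variables (G : topologicalGroupType) (H : subgroup G).

HB.instance Definition _ :=
  Topological.copy (subgroup_type H) (set_type (subgroup_set H)).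

Lemma subgroup_val_continuous :
  continuous (val : subgroup_type H -> G).
Proof. exact: initial_continuous. Qed.

Lemma subgroup_continuous (T : topologicalType) (f : T -> subgroup_type H) :
  continuous (val \o f) -> continuous f.
Proof.
move=> /continuousP cf; apply/continuousP => _ [B oB <-].
exact: cf.
Qed.

Lemma subgroup_mulg_continuous :
  continuous (fun p : subgroup_type H * subgroup_type H => p.1 * p.2).
Proof.
apply: subgroup_continuous.
rewrite (_ : _ \o _ = fun p : subgroup_type H * subgroup_type H =>
    val p.1 * val p.2); last by apply/funext => p; exact: valM.
apply: continuous_mulg => x; apply: continuous_comp.
- exact: cvg_fst.
- exact: subgroup_val_continuous.
- exact: cvg_snd.
- exact: subgroup_val_continuous.
Qed.

Lemma subgroup_invg_continuous :
  continuous (fun x : subgroup_type H => x^-1).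
Proof.
apply: subgroup_continuous.
rewrite (_ : _ \o _ = (fun y : G => y^-1) \o val); last first.
  by apply/funext => y; exact: (gmulfV (val : subgroup_type H -> G)).
move=> x; apply: continuous_comp.
  exact: subgroup_val_continuous.
exact: invg_continuous.
Qed.

Lemma subgroup_hausdorff : hausdorff_space (subgroup_type H).
Proof.
move=> x y xy; apply: val_inj; apply: (@topgroup_hausdorff G) => A B nA nB.
have [z [Az Bz]] := xy _ _ (subgroup_val_continuous nA) (subgroup_val_continuous nB).
by exists (val z).
Qed.

HB.instance Definition _ := isTopologicalGroup.Build (subgroup_type H)
  subgroup_mulg_continuous subgroup_invg_continuous subgroup_hausdorff.

End TopologicalSubgroup.

Section SubgroupConstructions.

Lemma image_subgroup_subproof (G H : groupType) (f : UMagmaMorphism.type G H)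
  (V : subgroup G) : is_subgroup (f @` V).
Proof.
have [V1 VM VV] := (is_subgroupP V).1 (subgroupP V).
apply/is_subgroupP; split.
- by exists 1; rewrite ?gmulf1.
- move=> _ _ [x Vx <-] [y Vy <-]; exists (x * y); first exact: VM.
  by rewrite gmulfM.
- by move=> _ [x Vx <-]; exists x^-1; [exact: VV|rewrite gmulfV].
Qed.

Definition image_subgroup (G H : groupType) (f : UMagmaMorphism.type G H)
    (V : subgroup G) : subgroup H :=
  Subgroup (image_subgroup_subproof f V).

Lemma closure_subgroup_subproof (G : topologicalGroupType) (V : subgroup G) :
  is_subgroup (closure V).
Proof.
have [V1 VM VV] := (is_subgroupP V).1 (subgroupP V).
apply/is_subgroupP; split.
- exact: subset_closure.
- move=> x y Vx Vy A /(mulg_continuous (x, y))[[B C] [/= xB yC] BCA].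
  have [b [Vb Bb]] := Vx _ xB; have [c [Vc Cc]] := Vy _ yC.
  by exists (b * c); split; [exact: VM|exact: (BCA (b, c))].
- move=> x Vx A /(invg_continuous x) /Vx[b [Vb Ab]].
  by exists b^-1; split => //; exact: VV.
Qed.

Definition closure_subgroup (G : topologicalGroupType) (V : subgroup G) :
  subgroup G := Subgroup (closure_subgroup_subproof V).

End SubgroupConstructions.

Definition prod_group (I : eqType) (K : I -> topologicalGroupType) : Type :=
  prod_topology K.

Section ProdGroup.
Variables (I : eqType) (K : I -> topologicalGroupType).
Implicit Types x y z : prod_group K.

HB.instance Definition _ := Topological.copy (prod_group K) (prod_topology K).

Definition prod_one : prod_group K := fun i => 1.
Definition prod_mul x y : prod_group K := fun i => x i * y i.
Definition prod_inv x : prod_group K := fun i => (x i)^-1.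

Lemma prod_mulA : associative prod_mul.
Proof. by move=> x y z; apply: functional_extensionality_dep => i; exact: mulgA. Qed.

Lemma prod_mul1g : left_id prod_one prod_mul.
Proof. by move=> x; apply: functional_extensionality_dep => i; exact: mul1g. Qed.

Lemma prod_mulg1 : right_id prod_one prod_mul.
Proof. by move=> x; apply: functional_extensionality_dep => i; exact: mulg1. Qed.

Lemma prod_mulVg : left_inverse prod_one prod_inv prod_mul.
Proof. by move=> x; apply: functional_extensionality_dep => i; exact: mulVg. Qed.

Lemma prod_mulgV : right_inverse prod_one prod_inv prod_mul.
Proof. by move=> x; apply: functional_extensionality_dep => i; exact: mulgV. Qed.

HB.instance Definition _ := isGroup.Build (prod_group K)
  prod_mulA prod_mul1g prod_mulg1 prod_mulVg prod_mulgV.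

Lemma prod_group_proj (i : I) : continuous (fun x : prod_group K => x i).
Proof. exact: (@proj_continuous I K i). Qed.

Lemma prod_group_continuous (T : topologicalType) (f : T -> prod_group K) :
  (forall i, continuous (fun t => f t i)) -> continuous f.
Proof.
move=> cf t; apply/cvg_sup => i A [_ [[B oB <-] Bft BA]].
apply: filterS BA _; apply: (cf i t); exact: open_nbhs_nbhs.
Qed.

Lemma prod_group_mulg_continuous :
  continuous (fun p : prod_group K * prod_group K => p.1 * p.2).
Proof.
apply: prod_group_continuous => i; apply: continuous_mulg => x.
  apply: (@continuous_comp _ _ _ fst (fun y : prod_group K => y i)).
    exact: cvg_fst.
  exact: prod_group_proj.
apply: (@continuous_comp _ _ _ snd (fun y : prod_group K => y i)).
  exact: cvg_snd.
exact: prod_group_proj.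
Qed.

Lemma prod_group_invg_continuous : continuous (fun x : prod_group K => x^-1).
Proof.
apply: prod_group_continuous => i x A nA.
exact: (@prod_group_proj i x _ (@invg_continuous (K i) (x i) A nA)).
Qed.

Lemma prod_group_hausdorff : hausdorff_space (prod_group K).
Proof.
move=> x y xy; apply: functional_extensionality_dep => i.
apply: topgroup_hausdorff => A B nA nB.
have [z [Az Bz]] := xy _ _ (@prod_group_proj i x _ nA) (@prod_group_proj i y _ nB).
by exists (z i).
Qed.

HB.instance Definition _ := isTopologicalGroup.Build (prod_group K)
  prod_group_mulg_continuous prod_group_invg_continuous prod_group_hausdorff.

End ProdGroup.

Record normal_subgroup (K : groupType) := NormalSubgroup {
  normal_subgroup_subgroup :> subgroup K;
  normal_subgroupP : forall g,
    conjset g normal_subgroup_subgroup `<=` normal_subgroup_subgroup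
}.

HB.instance Definition _ (K : groupType) := gen_eqMixin (normal_subgroup K).
HB.instance Definition _ (K : groupType) := gen_choiceMixin (normal_subgroup K).

(* The cosets of N under setwise multiplication, with the discrete topology. *)
Definition quotient (K : groupType) (N : normal_subgroup K) : Type :=
  set_type (range (rcoset N)).

Section Quotient.
Variables (K : groupType) (N : normal_subgroup K).
Implicit Types A B C : quotient N.

HB.instance Definition _ :=
  Topological.copy (quotient N) (discrete_topology (set_type (range (rcoset N)))).

Definition to_quotient (g : K) : quotient N :=
  exist (fun X => X \in range (rcoset N)) (rcoset N g)
    (mem_set (imageT (rcoset N) g)).

Lemma normal_rcosetM g h :
  mulset (rcoset N g) (rcoset N h) = rcoset N (g * h).
Proof.
apply: rcosetM; [exact: subgroupP| |exact: subgroupP].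
move=> x Nx; apply/conjsetP; rewrite invgK.
by apply: (@normal_subgroupP _ N g); exists x.
Qed.

Lemma normal_rcosetV g : invset (rcoset N g) = rcoset N g^-1.
Proof.
rewrite rcoset_inv; last exact: subgroupP.
congr rcoset; apply/seteqP; split; first exact: normal_subgroupP.
move=> x Nx; apply/conjsetP; rewrite invgK.
by apply: (@normal_subgroupP _ N g); exists x.
Qed.

Lemma quotientP A : exists g, val A = rcoset N g.
Proof. by case: A => A /= /set_mem[g _ <-]; exists g. Qed.

Lemma mul_quotient_subproof A B :
  mulset (val A) (val B) \in range (rcoset N).
Proof.
have [g ->] := quotientP A; have [h ->] := quotientP B.
by apply/mem_set; exists (g * h) => //; rewrite normal_rcosetM.
Qed.

Lemma inv_quotient_subproof A : invset (val A) \in range (rcoset N).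
Proof.
have [g ->] := quotientP A.
by apply/mem_set; exists g^-1 => //; rewrite normal_rcosetV.
Qed.

Definition mul_quotient A B : quotient N := 
  exist (fun X => X \in range (rcoset N)) _ (mul_quotient_subproof A B).
Definition inv_quotient A : quotient N := 
  exist (fun X => X \in range (rcoset N)) _ (inv_quotient_subproof A).

Lemma mul_quotientA : associative mul_quotient.
Proof. by move=> A B C; apply: val_inj => /=; exact: mulsetA. Qed.

Lemma mul1_quotient : left_id (to_quotient 1) mul_quotient.
Proof.
move=> A; apply: val_inj => /=; have [g ->] := quotientP A.
by rewrite normal_rcosetM mul1g.
Qed.

Lemma mul_quotient1 : right_id (to_quotient 1) mul_quotient.
Proof.
move=> A; apply: val_inj => /=; have [g ->] := quotientP A.
by rewrite normal_rcosetM mulg1.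
Qed.

Lemma mulV_quotient : left_inverse (to_quotient 1) inv_quotient mul_quotient.
Proof.
move=> A; apply: val_inj => /=; have [g ->] := quotientP A.
by rewrite normal_rcosetV normal_rcosetM mulVg.
Qed.

Lemma mul_quotientV : right_inverse (to_quotient 1) inv_quotient mul_quotient.
Proof.
move=> A; apply: val_inj => /=; have [g ->] := quotientP A.
by rewrite normal_rcosetV normal_rcosetM mulgV.
Qed.

HB.instance Definition _ := isGroup.Build (quotient N)
  mul_quotientA mul1_quotient mul_quotient1 mulV_quotient mul_quotientV.

Lemma quotient_nbhs A (X : set (quotient N)) : X A -> nbhs A X.
Proof. by move=> XA; apply/principal_filterP. Qed.

Lemma quotient_mulg_continuous :
  continuous (fun p : quotient N * quotient N => p.1 * p.2).
Proof.
move=> [A B] X /nbhs_singleton XAB.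
exists ([set A], [set B]); first by split; exact: quotient_nbhs.
by move=> [C D] [/= -> ->].
Qed.

Lemma quotient_invg_continuous : continuous (fun A : quotient N => A^-1).
Proof. by move=> A X /nbhs_singleton XA; exact: quotient_nbhs. Qed.

Lemma quotient_hausdorff : hausdorff_space (quotient N).
Proof.
move=> A B AB.
by have [_ [-> ->]] := AB [set A] [set B] (quotient_nbhs erefl) (quotient_nbhs erefl).
Qed.

HB.instance Definition _ := isTopologicalGroup.Build (quotient N)
  quotient_mulg_continuous quotient_invg_continuous quotient_hausdorff.

End Quotient.

Section ProfiniteCompletion.
Variables (K : groupType) (F : set (normal_subgroup K)).

(* For N contained in M, the projection K/N -> K/M sends a coset of N to the
   coset of M which contains it. *)
Definition inverse_limit_set :
    set (prod_group (fun N : F => quotient (val N) : topologicalGroupType)) :=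
  [set x | forall N M : F, val N `<=` val M -> val (x N) `<=` val (x M)].

Lemma inverse_limit_subproof : is_subgroup inverse_limit_set.
Proof.
apply/is_subgroupP; split.
- by move=> N M NM /= x /rcosetP Nx; apply/rcosetP/NM.
- move=> x y Lx Ly N M NM _ [a xa [b yb <-]].
  by exists a; [exact: Lx NM _ xa|exists b => //; exact: Ly NM _ yb].
- move=> x Lx N M NM a /invsetP xa; apply/invsetP; exact: Lx NM _ xa.
Qed.

Definition inverse_limit := Subgroup inverse_limit_subproof.

Definition profinite_completion : topologicalGroupType :=
  subgroup_type inverse_limit.

Lemma to_profinite_subproof (k : K) :
  (fun N : F => to_quotient (val N) k) \in inverse_limit_set.
Proof.
by apply/mem_set => N M NM x /rcosetP Nx; apply/rcosetP/NM.
Qed.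

Definition to_profinite (k : K) : profinite_completion :=
  exist (fun x => x \in inverse_limit_set) _ (to_profinite_subproof k).

End ProfiniteCompletion.

Definition topgroup_isomorphism (G H : topologicalGroupType) (f : G -> H) : Prop :=
  [/\ monoid_morphism f, continuous f &
      exists f' : H -> G, [/\ cancel f f', cancel f' f & continuous f']].

Definition tdlc (G : topologicalGroupType) : Prop :=
  totally_disconnected [set: G] /\ locally_compact [set: G].

Definition tdlc_completion (G H : topologicalGroupType) (f : G -> H) : Prop :=
  [/\ tdlc H, monoid_morphism f, continuous f & dense (range f)].

Definition compact_open_subgroups (G : topologicalGroupType) : set (set G) :=
  [set U | [/\ is_subgroup U, compact U & open U]].

(* The members of S which are normal subgroups of V.  They have finite index in
   V because members of S are commensurate. *)
Definition normal_in_filter (G : topologicalGroupType) (S : local_filter G)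
    (V : subgroup G) : set (normal_subgroup (subgroup_type V)) :=
  [set N | S (val @` (N : set (subgroup_type V)))].

Arguments compact_open_subgroups G : clear implicits.
Arguments normal_in_filter {G} S V _.

(* Main.v *)
From HB Require Import structures.
Require Import Defs.
From mathcomp Require Import all_boot all_order.
From mathcomp Require Import finmap.
From mathcomp Require Import all_classical topology.

(** The sets of Cauchy filters containing a given coset [rcoset V g], [V] in
    [S], are a base of the topology of the completion.  Each of them is clopen,
    because distinct cosets of [V] give disjoint sets, and is the closure of the
    image of [rcoset V g].  Everything rests on the compactness of these sets:
    for [W] in [S], commensurability makes finitely many cosets of [V `&` W]
    cover [rcoset V g], so an ultrafilter on Cauchy filters selects one coset of
    each member of [S], and the selected cosets generate a Cauchy filter to
    which it converges ([containing_compact]).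

    A Hausdorff space with a base of compact open sets is totally disconnected
    and locally compact.  A compact open subgroup [R] contains the closure of
    the image of some [U] in [S] and is covered by finitely many translates of
    it, so the preimage of [R] contains [U] with finite index and lies in [S]
    ([preimage_compact_open]); the two maps of the correspondence are inverse to
    each other because the image of [G] is dense and because a Cauchy filter
    [beta S x] contains [V] only if [x] lies in [V].

    For the comparison with the profinite completion, a Cauchy filter containing
    [V] selects one coset of every [N] in [S] normal in [V], and these cosets
    form a point of the inverse limit; conversely the cosets of such a point
    generate a Cauchy filter, because every [W] in [S] contains some [N]
    ([normal_core]).  This relation [matches] is one-to-one.  It is compatible
    with products because the product filter contains the products of the
    members of its factors, and it is a homeomorphism because on both sides a
    basic neighbourhood prescribes a coset. *)

Set Implicit Arguments.
Unset Strict Implicit.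
Unset Printing Implicit Defensive.

Local Open Scope classical_set_scope.
Local Open Scope group_scope.

(** * Cosets and ultrafilters *)

Lemma rcosetS (G : groupType) (V W : set G) g :
  V `<=` W -> rcoset V g `<=` rcoset W g.
Proof. by move=> VW x /rcosetP Vx; apply/rcosetP/VW. Qed.

Lemma rcoset1 (G : groupType) (V : set G) : rcoset V 1 = V.
Proof.
by apply/seteqP; split=> x; [move=> /rcosetP|move=> Vx; apply/rcosetP];
  rewrite invg1 mulg1.
Qed.

Lemma quotient_coset (L : groupType) (N : normal_subgroup L) (A : quotient N)
  (k : L) : val A k -> A = to_quotient N k.
Proof.
have [h AE] := quotientP A; rewrite AE => Nk; apply: val_inj.
by rewrite AE; apply/esym/rcoset_eq => //; exact: subgroupP.
Qed.

Lemma to_quotient_surj (L : groupType) (N : normal_subgroup L)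
    (A : quotient N) : exists k, A = to_quotient N k.
Proof. by have [k Ak] := quotientP A; exists k; apply: val_inj. Qed.

Lemma ultra_finite_bigcup (T : Type) (F : set_system T) (I : choiceType)
    (D : set I) (B : I -> set T) : UltraFilter F -> finite_set D ->
  F (\bigcup_(i in D) B i) -> exists2 i, D i & F (B i).
Proof.
move=> FU /finite_fsetP[X ->] FB; apply: contrapT => nB.
have FC : F (\bigcap_(i in [set` X]) ~` B i).
  apply: filter_bigI => i iX; have [FBi|//] := in_ultra_setVsetC (B i) FU.
  by exfalso; apply: nB; exists i.
have [x [[i iX Bix] nBx]] := filter_ex (filterI FB FC).
exact: (nBx i).
Qed.

(** * Compact open sets of the completion *)

Section CompactOpenSets.
Variables (G : topologicalGroupType) (S : local_filter G).
Implicit Types (U V W : set G) (f : completion S).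
#[local] Existing Instance cfF.

Definition containing (C : set G) : set (completion S) :=
  [set f : completion S | f C].

Lemma containingS A B : A `<=` B -> containing A `<=` containing B.
Proof. by move=> AB f; exact: filterS. Qed.

Lemma beta_containing V g x : S V ->
  containing (rcoset V g) (beta S x) <-> rcoset V g x.
Proof.
move=> SV0; have Vs := local_filter_subgroup SV0; split=> [bx|Vx].
  by rewrite (cf_uniq SV0 bx (beta_rcoset x SV0)); exact: rcoset_id.
rewrite /containing /= -(rcoset_eq Vs Vx); exact: beta_rcoset.
Qed.

Lemma containing_nbhs V g f : S V -> containing (rcoset V g) f ->
  nbhs f (containing (rcoset V g)).
Proof. by move=> SV0 fg; apply/nbhs_completionP; exists V, g; split. Qed.

Lemma containing_open V g : S V -> open (containing (rcoset V g)).
Proof. by move=> SV0; rewrite openE => f fg; exact: containing_nbhs. Qed.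

(** A Cauchy filter outside the set contains another coset of [V], and cosets of
    [V] in a common Cauchy filter are equal. *)
Lemma containing_closed V g : S V -> closed (containing (rcoset V g)).
Proof.
move=> SV0; rewrite -openC openE => f nfg; have [h fh] := cf_ex f SV0.
change (nbhs f (~` containing (rcoset V g))).
apply: filterS (containing_nbhs SV0 fh) => f' f'h f'g; apply: nfg.
by rewrite (cf_uniq SV0 f'g f'h).
Qed.

(** A neighbourhood of [f] contains the image not just of one element of [G]
    but of a whole coset belonging to [f]; this is how density of the image is
    used. *)
Lemma beta_image_dense f A : nbhs f A ->
  exists V g, [/\ S V, f (rcoset V g) & rcoset V g `<=` beta S @^-1` A].
Proof.
move=> /nbhs_completionP[V [g [SV0 fg VA]]]; exists V, g; split=> // x Vx.
by apply: VA; apply/beta_containing.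
Qed.

Lemma closure_beta_rcoset V g : S V ->
  closure (beta S @` rcoset V g) = containing (rcoset V g).
Proof.
move=> SV0; apply/seteqP; split.
  move=> f clf; apply: (containing_closed SV0) => A /clf[_ [[x Vx <-] Ax]].
  by exists (beta S x); split=> //; apply/beta_containing.
move=> f fg A /beta_image_dense[U [h [SU fh UA]]].
have [x [Vx Ux]] := cf_meet fg fh.
by exists (beta S x); split; [exists x|exact: UA].
Qed.

Lemma closure_beta V : S V -> closure (beta S @` V) = containing V.
Proof.
by move=> SV0; rewrite -{1 2}(rcoset1 V); exact: closure_beta_rcoset.
Qed.

Lemma beta_continuous : continuous (beta S).
Proof.
move=> x A /nbhs_completionP[V [g [SV0 xg VA]]].
move: (xg) => /(beta_containing _ _ SV0) Vx.
have oV := local_filter_open SV0.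
have ctr : continuous (fun y : G => y * g^-1).
  apply: continuous_mulg; [by move=> y; exact: cvg_id|exact: cst_continuous].
apply: (@filterS _ _ _ ((fun y => y * g^-1) @^-1` V)).
  by move=> y Vy; apply: VA; apply/beta_containing => //; apply/rcosetP.
apply: ctr; apply: open_nbhs_nbhs; split=> //; exact/rcosetP.
Qed.

Lemma completion_totally_disconnected :
  totally_disconnected [set: completion S].
Proof.
apply: zero_dimension_totally_disconnected => f f' /eqP ff'.
apply: contrapT => nsep; apply: ff'; apply: cf_sub_eq => V g SV0 fg.
apply: contrapT => nf'g; apply: nsep.
exists (containing (rcoset V g)); split=> //.
by split; [exact: containing_open|exact: containing_closed].
Qed.

(** The cosets are indexed by elements of [V] so that the union is finite when
    [W] has finite index in [V]. *)
Lemma containing_bigcup V W g : S V -> S W -> W `<=` V ->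
  containing (rcoset V g) `<=`
  \bigcup_(C in [set rcoset W v | v in V]) containing (rcoset C g).
Proof.
move=> SV0 SW WV f fg; have [h fh] := cf_ex f SW.
have [x [/rcosetP Vx Wx]] := cf_meet fg fh.
exists (rcoset W (x * g^-1)); first by exists (x * g^-1).
rewrite /containing /=; apply: filterS fh => y.
rewrite -(rcoset_eq (local_filter_subgroup SW) Wx) => /rcosetP Wy.
by apply/rcosetP/rcosetP; rewrite invgM invgK -mulgA mulKg.
Qed.

(** The finite index of [V `&` W] in [V] lets the ultrafilter decide which coset
    of [W] to follow. *)
Lemma ultra_containing V W g (F : set_system (completion S)) : UltraFilter F ->
  S V -> S W -> F (containing (rcoset V g)) ->
  exists h, F (containing (rcoset W h)).
Proof.
move=> FU SV0 SW FV; have SD := local_filterI SV0 SW.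
have [_ fin] := local_filter_commensurate SW SV0.
rewrite setIC in fin.
have [|_ [v Vv <-] FC] :=
    @ultra_finite_bigcup _ F _ _ (fun C => containing (rcoset C g)) FU fin.
  by apply: filterS FV; apply: containing_bigcup => //; exact: subIsetl.
exists (v * g); apply: filterS FC; apply: containingS => x.
move=> /rcosetP/rcosetP[_ Wx]; by apply/rcosetP; rewrite invgM mulgA.
Qed.

(** The cosets followed by an ultrafilter are compatible with each other, since
    two sets of the ultrafilter meet in an actual Cauchy filter; hence they
    generate a Cauchy filter, which is the limit. *)
Lemma containing_compact V g : S V -> compact (containing (rcoset V g)).
Proof.
move=> SV0; rewrite compact_ultra => F FU FV.
(* The candidate limit, generated by the cosets followed by [F]. *)
pose f0 A := exists W h,
  [/\ S W, F (containing (rcoset W h)) & rcoset W h `<=` A].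
have f0in W h : S W -> F (containing (rcoset W h)) -> f0 (rcoset W h).
  by move=> SW FW; exists W, h; split.
have f0P : cauchy_filter S f0.
  apply: cauchy_filterI.
  - split.
    + by exists V, g; split.
    + move=> A B [U [h [SU FUh UA]]] [W [k [SW FWk WB]]].
      have SD := local_filterI SU SW.
      have [l FDl] := ultra_containing FU SV0 SD FV.
      have [f [[fh fk] fl]] := filter_ex (filterI (filterI FUh FWk) FDl).
      exists (U `&` W), l; split=> // x Dx; split.
        apply: UA; rewrite -(cf_nest SD SU (@subIsetl _ _ _) fl fh).
        exact: rcosetS Dx.
      apply: WB; rewrite -(cf_nest SD SW (@subIsetr _ _ _) fl fk).
      exact: rcosetS Dx.
    + move=> A B AB [W [h [SW FW WA]]]; exists W, h; split=> //.
      exact: subset_trans AB.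
  - move=> W SW; have [h FW] := ultra_containing FU SV0 SW FV; exists h.
    exact: f0in.
  - move=> A [W [h [SW FW WA]]]; exists W, h.
    by split=> //; exact: f0in.
exists (Completion f0P); split; first exact: f0in.
move=> A /nbhs_completionP[U [h [SU [W [k [SW FW WU]]] UA]]].
exact: filterS (subset_trans (containingS WU) UA) FW.
Qed.

Lemma completion_locally_compact : locally_compact [set: completion S].
Proof.
move=> f _.
have [V SV0] := local_filter_nonempty S; have [g fg] := cf_ex f SV0.
exists (containing (rcoset V g)).
  by rewrite withinET; exact: containing_nbhs.
split; [exact: containing_compact|exact: containing_closed].
Qed.

Lemma beta_tdlc_completion : tdlc_completion (beta S).
Proof.
split.
- split; [exact: completion_totally_disconnected|
          exact: completion_locally_compact].
- exact: beta_morphism.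
- exact: beta_continuous.
- move=> O [f Of] oO.
  have [V [g [SV0 _ VO]]] := beta_image_dense (open_nbhs_nbhs (conj oO Of)).
  exists (beta S g); split; last by exists g.
  by apply: VO; exact: rcoset_id (local_filter_subgroup SV0).
Qed.

(** [R] contains the closure of the image of some [U] in [S], whose cosets cover
    the compact set [R]; a finite subcover bounds the index of [U] in the
    preimage of [R]. *)
Lemma preimage_compact_open R : compact_open_subgroups (completion S) R ->
  S (beta S @^-1` R).
Proof.
move=> [/is_subgroupP[R1 RM RV] Rc Ro].
have [U [g [SU bg UR]]] : exists V g, [/\ S V, beta S 1 (rcoset V g) &
    containing (rcoset V g) `<=` R].
  by apply/nbhs_completionP/open_nbhs_nbhs.
have Us := local_filter_subgroup SU.
move/(beta_containing _ _ SU)/(rcoset_eq Us): bg; rewrite rcoset1 => UE.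
rewrite -{}UE in UR.
apply: (@local_filterS _ S U) => //.
- apply/is_subgroupP; split.
  + by rewrite /= gmulf1.
  + by move=> x y; rewrite /= gmulfM; exact: RM.
  + by move=> x; rewrite /= gmulfV; exact: RV.
- move=> x Ux; apply: UR; rewrite -(rcoset1 U) in Ux *.
  exact/beta_containing.
- (* A base point, so that open covers of [R] have finite subcovers. *)
  pose T : ptopologicalType :=
    HB.pack (completion S) (isPointed.Build (completion S) (beta S 1)).
  move: (Rc : @compact T R); rewrite compact_cover.
  move=> /(_ G setT (fun h => containing (rcoset U h))).
  case=> [h _|f Rf|D _ RD]; first exact: containing_open.
    by have [h fh] := cf_ex f SU; exists h.
  apply: (@sub_finite_set _ _ [set rcoset U h | h in [set` D]]).
    move=> _ [x Rx <-]; have [h hD xh] := RD _ Rx.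
    move: xh => /(beta_containing _ _ SU)/(rcoset_eq Us) xh; by exists h.
  exact/finite_image/finite_fset.
Qed.

Lemma closure_compact_open V : S V ->
  compact_open_subgroups (completion S) (closure (beta S @` V)).
Proof.
move=> SV0; split.
- exact: (subgroupP (closure_subgroup
    (image_subgroup (beta S) (Subgroup (local_filter_subgroup SV0))))).
- by rewrite closure_beta // -(rcoset1 V); exact: containing_compact.
- by rewrite closure_beta // -(rcoset1 V); exact: containing_open.
Qed.

Lemma closure_preimage R : compact_open_subgroups (completion S) R ->
  closure (beta S @` (beta S @^-1` R)) = R.
Proof.
move=> [_ Rc Ro]; apply/seteqP; split.
  have Rcl := compact_closed (@topgroup_hausdorff (completion S)) Rc.
  move=> f clf; apply: Rcl => A /clf[_ [[x Rx <-] Ax]].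
  by exists (beta S x).
move=> f Rf A fA.
have [|V [g [SV0 _ VA]]] := @beta_image_dense f (R `&` A).
  by apply: filterI => //; exact: open_nbhs_nbhs.
have [Rg Ag] := VA _ (rcoset_id g (local_filter_subgroup SV0)).
by exists (beta S g); split=> //; exists g.
Qed.

Lemma preimage_closure V : S V -> beta S @^-1` closure (beta S @` V) = V.
Proof.
move=> SV0; rewrite closure_beta // -[in LHS](rcoset1 V) -[RHS](rcoset1 V).
by apply/seteqP; split=> x /(beta_containing _ _ SV0).
Qed.

End CompactOpenSets.

(** * Comparison with the profinite completion *)

Section Profinite.
Variables (G : topologicalGroupType) (S : local_filter G) (V : subgroup G).
Hypothesis SV0 : S V.
Implicit Types f : completion S.

Notation F := (normal_in_filter S V).
Notation K := (subgroup_type V).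
Notation clV := (subgroup_type (closure_subgroup (image_subgroup (beta S) V))).
Notation limV := (profinite_completion F).

(** Seen in [G], so that it can belong to a Cauchy filter on [G]. *)
Definition coset_set (N : F) (A : quotient (val N)) : set G :=
  val @` (val A : set K).

Lemma coset_set_rcoset (N : F) (k : K) :
  coset_set (to_quotient (val N) k) = rcoset (val @` (val N : set K)) (val k).
Proof.
apply/seteqP; split=> x.
  case=> h /rcosetP Nh <-; apply/rcosetP.
  by exists (h * k^-1).
case=> _ [n Nn <-] <-; exists (n * k) => //.
by apply/rcosetP; rewrite mulgK.
Qed.

(** The intersection of the [V]-conjugates of [V `&` W]: there are finitely many
    of them by commensurability, so it stays in [S]. *)
Lemma normal_core W : S W -> exists N : F, val @` (val N : set K) `<=` W.
Proof.
move=> SW; have [N [SN NV NW NJ]] := S_core SV0 SW.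
have [N1 NM NI] := (is_subgroupP N).1 (local_filter_subgroup SN).
have Ps : is_subgroup ((val : K -> G) @^-1` N).
  apply/is_subgroupP; split.
  - exact: N1.
  - by move=> x y; exact: NM.
  - by move=> x; exact: NI.
have PJ g : conjset g (Subgroup Ps) `<=` Subgroup Ps.
  move=> x /conjsetP Nx.
  have {}Nx : N ((val g)^-1 * val x * val g) by exact: Nx.
  have := NJ (val g)^-1 _ (set_mem (valP g^-1)) Nx.
  by rewrite invgK !mulgA mulgV mul1g mulgK.
have PE : (val : K -> G) @` ((val : K -> G) @^-1` N) = N.
  apply/seteqP; split=> [_ [x Nx <-] //|x Nx].
  by exists (exist (fun x => x \in (V : set G)) x (mem_set (NV _ Nx))).
have FP : F (NormalSubgroup PJ) by rewrite /normal_in_filter /= PE.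
by exists (exist (fun N => N \in F) _ (mem_set FP)); rewrite /= PE.
Qed.

Lemma normal_S (N : F) : S (val @` (val N : set K)).
Proof. exact: set_mem (valP N). Qed.

(** The graph of the isomorphism; as a relation it serves both directions. *)
Definition matches f (y : limV) : Prop :=
  forall N : F, f (coset_set (val y N)).

(** The product filter contains the products of members of the factors, and the
    product of two cosets of [N] is their product in the quotient. *)
Lemma matches_mul f f' y y' : matches f y -> matches f' y' ->
  matches (f * f') (y * y').
Proof.
move=> fy f'y' N; exists (coset_set (val y N), coset_set (val y' N)) => //=.
move=> _ [_ [a ya <-] [_ [b yb <-] <-]]; exists (a * b) => //.
by exists a => //; exists b.
Qed.

Lemma matches_beta (k : K) : matches (beta S (val k)) (to_profinite F k).
Proof. move=> N; rewrite coset_set_rcoset; exact: beta_rcoset (normal_S N). Qed.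

(** The two cosets share an element of [V], since both belong to [f]; this one
    fact gives compatibility of the selected cosets and, for [N = M], their
    uniqueness. *)
Lemma cf_coset_sub f (N M : F) (A : quotient (val N)) (B : quotient (val M)) :
  val N `<=` val M -> f (coset_set A) -> f (coset_set B) -> val A `<=` val B.
Proof.
move=> NM fA fB; have [_ [[k Ak <-] [k' Bk /val_inj kk']]] := cf_meet fA fB.
rewrite {}kk' in Bk; rewrite (quotient_coset Ak) (quotient_coset Bk).
exact: rcosetS.
Qed.

Lemma cf_coset_uniq f (N : F) (A B : quotient (val N)) :
  f (coset_set A) -> f (coset_set B) -> A = B.
Proof.
move=> fA fB; apply/val_inj/seteqP.
by split; [exact: cf_coset_sub fA fB|exact: cf_coset_sub fB fA].
Qed.

Lemma matches_inj f y y' : matches f y -> matches f y' -> y = y'.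
Proof.
move=> fy fy'; apply/val_inj/functional_extensionality_dep => N.
exact: cf_coset_uniq (fy N) (fy' N).
Qed.

(** The subgroups [N] are cofinal in [S], so the cosets of the [N] determine a
    Cauchy filter. *)
Lemma matches_injl f f' y : matches f y -> matches f' y -> f = f'.
Proof.
move=> fy f'y; apply: cf_eq => W SW; have [N NW] := normal_core SW.
have := f'y N; have := fy N; have [k ->] := to_quotient_surj (val y N).
rewrite coset_set_rcoset => fk f'k.
by exists (val k); [move: fk|move: f'k]; apply: containingS; exact: rcosetS.
Qed.

Lemma matches_ex f : containing V f -> exists y, matches f y.
Proof.
move=> fV.
have fA (N : F) : {A : quotient (val N) | f (coset_set A)}.
  apply: cid; have [g fg] := cf_ex f (normal_S N).
  have [x [Vx /rcoset_eq gx]] := cf_meet fV fg.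
  exists (to_quotient (val N)
    (exist (fun x => x \in (V : set G)) x (mem_set Vx))).
  rewrite coset_set_rcoset /= gx //.
  exact: local_filter_subgroup (normal_S N).
pose z : prod_group (fun N : F => quotient (val N) : topologicalGroupType) :=
  fun N => sval (fA N).
have zP : z \in @inverse_limit_set _ F.
  apply/mem_set => N M NM.
  exact: cf_coset_sub NM (svalP (fA N)) (svalP (fA M)).
exists (exist (fun z => z \in @inverse_limit_set _ F) z zP) => N.
exact: (svalP (fA N)).
Qed.

(** The cosets forming [y] generate a filter because the cosets of [N] and [M]
    both contain that of a normal subgroup inside [N `&` M]. *)
Lemma ex_matches y : exists2 f, containing V f & matches f y.
Proof.
pose f0 (A : set G) := exists N : F, coset_set (val y N) `<=` A.
have f0P : cauchy_filter S f0.
  apply: cauchy_filterI.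
  - split.
    + by have [N _] := normal_core SV0; exists N.
    + move=> A B [N NA] [M MB].
      have [L LNM] := normal_core (local_filterI (normal_S N) (normal_S M)).
      have sub (P : F) : val @` (val L : set K) `<=` val @` (val P : set K) ->
          coset_set (val y L) `<=` coset_set (val y P).
        move=> LP; apply/image_subset/(set_mem (valP y)) => k Lk.
        by have [|k' Pk' /val_inj <-] := LP (val k); first exists k.
      exists L => x Lx; split; [apply: NA|apply: MB]; apply: sub Lx.
        by move=> ? /LNM[].
      by move=> ? /LNM[].
    + by move=> A B AB [N NA]; exists N; exact: subset_trans AB.
  - move=> W SW; have [N NW] := normal_core SW.
    have [k yk] := to_quotient_surj (val y N); exists (val k), N.
    rewrite yk coset_set_rcoset; exact: rcosetS.
  - move=> A [N NA]; have [k yk] := to_quotient_surj (val y N).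
    exists (val @` (val N : set K)), (val k).
    rewrite -coset_set_rcoset -yk; split=> //; first exact: normal_S.
    by exists N.
exists (Completion f0P); last by move=> N; exists N.
have [N _] := normal_core SV0; exists N => _ [k _ <-].
exact: set_mem (valP k).
Qed.

Lemma closure_iso_profinite : exists h : clV -> limV,
  topgroup_isomorphism h /\
  forall (v : K) (x : clV), val x = beta S (val v) -> h x = to_profinite F v.
Proof.
have inV (x : clV) : containing V (val x).
  by rewrite -closure_beta //; exact: set_mem (valP x).
have [h hP] := choice (fun x => matches_ex (inV x)).
have exg y : exists x : clV, matches (val x) y.
  have [f fV fy] := ex_matches y; rewrite -closure_beta // in fV.
  by exists (exist (fun f => f \in closure (beta S @` V)) f (mem_set fV)).
have [g gP] := choice exg.
exists h; split; last first.
  move=> v x xv; apply: matches_inj (hP x) _; rewrite xv.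
  exact: matches_beta.
split.
- split.
    by apply: matches_inj (hP 1) _; exact: matches_beta 1.
  move=> x x'; apply: matches_inj (hP _) _; exact: matches_mul.
- apply: (@subgroup_continuous _ (inverse_limit F)).
  apply: prod_group_continuous => N x A /nbhs_singleton yA.
  have := hP x N; have [k yk] := to_quotient_surj (val (h x) N).
  rewrite yk coset_set_rcoset => xk.
  have nx : nbhs x
      (val @^-1` containing (rcoset (val @` (val N : set K)) (val k))).
    exact: subgroup_val_continuous (containing_nbhs (normal_S N) xk).
  apply: filterS nx.
  move=> x' x'k; rewrite /= (_ : val (h x') N = val (h x) N) //.
  rewrite /= /containing /= -coset_set_rcoset -yk in x'k.
  exact: cf_coset_uniq (hP x' N) x'k.
- exists g; split.
  + by move=> x; apply: val_inj; exact: matches_injl (gP _) (hP x).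
  + by move=> y; exact: matches_inj (hP _) (gP y).
  + apply: subgroup_continuous => y A /nbhs_completionP[W [c [SW gc WA]]].
    have [N NW] := normal_core SW.
    have oN : nbhs y [set y' : limV | val y' N = val y N].
      have nyN := quotient_nbhs (erefl : [set val y N] (val y N)).
      exact: (@subgroup_val_continuous _ (inverse_limit F) y _
        (@prod_group_proj _ _ N (val y) _ nyN)).
    apply: filterS oN => y' /= y'N; apply: WA; rewrite /=.
    have := gP y N; have := gP y' N; rewrite (y'N : val y' N = val y N).
    have [k ->] := to_quotient_surj (val y N).
    rewrite coset_set_rcoset => y'k yk.
    rewrite (cf_uniq SW gc (containingS (rcosetS NW) yk)).
    exact: (containingS (rcosetS NW) y'k).
Qed.

End Profinite.

Theorem theorem3p9 (G : topologicalGroupType) (S : local_filter G) :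
  [/\ tdlc_completion (beta S),
      [/\ forall R, compact_open_subgroups (completion S) R ->
            S (beta S @^-1` R),
          forall V, S V ->
            compact_open_subgroups (completion S) (closure (beta S @` V)),
          forall R, compact_open_subgroups (completion S) R ->
            closure (beta S @` (beta S @^-1` R)) = R
        & forall V, S V -> beta S @^-1` closure (beta S @` V) = V]
    & forall V : subgroup G, S V ->
        exists f : subgroup_type (closure_subgroup (image_subgroup (beta S) V)) ->
                   profinite_completion (normal_in_filter S V),
          topgroup_isomorphism f /\
          (forall (v : subgroup_type V)
             (x : subgroup_type (closure_subgroup (image_subgroup (beta S) V))),
             val x = beta S (val v) ->
             f x = to_profinite (normal_in_filter S V) v)].
Proof.
split.
- exact: beta_tdlc_completion.
- split.
  + exact: preimage_compact_open.
  + exact: closure_compact_open.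
  + exact: closure_preimage.
  + exact: preimage_closure.
- exact: closure_iso_profinite.
Qed.
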